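(* Let $\mu>0$, $m>0$, $\kappa\ge 0$ be fixed, and let $M\ge 2$ be an integer (a power of $2$). For $\overline{\gamma}>0$ and $i\in\{1,2\}$ let $$P_e^{(i)}(\overline{\gamma})=\int_0^\infty f_{\overline{\gamma}}(x)\,\mathcal{H}_i(x)\,dx$$ be the average error probability over the $\kappa$-$\mu$ shadowed fading channel with average signal-to-noise ratio $\overline{\gamma}$, for $M$-PSK modulation ($i=1$) and for DQPSK modulation with Gray coding ($i=2$), with $f_{\overline{\gamma}},\mathcal{H}_1,\mathcal{H}_2$ defined in the context. Then for both modulation schemes the diversity order equals $\mu$, i.e. $$\lim_{\overline{\gamma}\to\infty}\left(-\frac{\log P_e^{(i)}(\overline{\gamma})}{\log\overline{\gamma}}\right)=\mu,\qquad i=1,2.$$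
   Context: The $\kappa$-$\mu$ shadowed density of the signal-to-noise ratio is $$f_{\overline{\gamma}}(x)=\frac{\lambda}{\Gamma(\mu)}x^{\mu-1}e^{-\nu x}\,{}_1F_1(m;\mu;\omega x),\qquad x>0,$$ with $$\lambda=\frac{\mu^\mu m^m(1+\kappa)^\mu}{\overline{\gamma}^{\,\mu}(\mu\kappa+m)^m},\quad \nu=\frac{\mu(1+\kappa)}{\overline{\gamma}},\quad \omega=\frac{\mu^2\kappa(1+\kappa)}{\overline{\gamma}(\mu\kappa+m)},$$ where ${}_1F_1$ is the Kummer confluent hypergeometric function and $\Gamma$ is the Gamma function. The symbol error probability of $M$-PSK at signal-to-noise ratio $x$ per bit is $$\mathcal{H}_1(x)=\frac1\pi\int_0^{\frac{M-1}{M}\pi}\exp\left(-\frac{\varrho x}{\sin^2\theta}\right)d\theta,\qquad \varrho=\log_2(M)\sin^2(\pi/M).$$ The bit error probability of DQPSK with Gray coding is $$\mathcal{H}_2(x)=Q_1\left(a\sqrt{x},b\sqrt{x}\right)-\frac12 I_0\left(\sqrt2\,x\right)e^{-2x},$$ with $a=\sqrt{2(1-\sqrt{0.5})}$, $b=\sqrt{2(1+\sqrt{0.5})}$, where $I_0$ is the modified Bessel function of the first kind of order $0$ and $Q_1(\alpha,\beta)=\int_\beta^\infty t\exp\left(-\frac{t^2+\alpha^2}{2}\right)I_0(\alpha t)\,dt$ is the first-order Marcum $Q$-function. The diversity order is the limit of $-\log P_e/\log\overline{\gamma}$ as $\overline{\gamma}\to\infty$. *)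

(* Defs.v *)
From HB Require Import structures.
From mathcomp Require Import all_boot all_order all_algebra.
From mathcomp Require Import all_classical all_reals all_analysis.
Set Implicit Arguments.
Unset Strict Implicit.
Unset Printing Implicit Defensive.
Import Order.TTheory GRing.Theory Num.Theory.
Import numFieldNormedType.Exports.
Local Open Scope classical_set_scope.
Local Open Scope ring_scope.

(* All integrals are Lebesgue integrals, read as real numbers through
   [Rintegral]; in particular the integrals over ]0, +oo[ cover the singularity
   of x^(mu - 1) at 0 when mu < 1. *)

Definition Gamma (R : realType) (s : R) : R :=
  \int[lebesgue_measure]_(t in `]0, +oo[%classic) (t `^ (s - 1) * expR (- t)).

(* Pochhammer symbol a (a + 1) ... (a + n - 1). *)
Definition rising (R : realType) (a : R) (n : nat) : R :=
  \prod_(i < n) (a + i%:R).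

Definition hyp1F1 (R : realType) (a b z : R) : R :=
  limn (series (fun n : nat => rising a n / rising b n * (z ^+ n / n`!%:R))).

Definition besselI0 (R : realType) (x : R) : R :=
  limn (series (fun n : nat => (x / 2) ^+ (2 * n) / n`!%:R ^+ 2)).

Definition marcumQ1 (R : realType) (alpha beta : R) : R :=
  \int[lebesgue_measure]_(t in `[beta, +oo[%classic)
    (t * expR (- ((t ^+ 2 + alpha ^+ 2) / 2)) * besselI0 (alpha * t)).

Definition kms_lambda (R : realType) (kappa mu m gbar : R) : R :=
  (mu `^ mu * m `^ m * (1 + kappa) `^ mu) /
  (gbar `^ mu * (mu * kappa + m) `^ m).

Definition kms_nu (R : realType) (kappa mu gbar : R) : R :=
  mu * (1 + kappa) / gbar.

Definition kms_omega (R : realType) (kappa mu m gbar : R) : R :=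
  (mu ^+ 2 * kappa * (1 + kappa)) / (gbar * (mu * kappa + m)).

(* Density of the kappa-mu shadowed signal-to-noise ratio; meaningful for
   0 < x, the only range over which it is integrated. *)
Definition kms_density (R : realType) (kappa mu m gbar x : R) : R :=
  kms_lambda kappa mu m gbar / Gamma mu * x `^ (mu - 1)
  * expR (- (kms_nu kappa mu gbar * x))
  * hyp1F1 m mu (kms_omega kappa mu m gbar * x).

Definition log2 (R : realType) (x : R) : R := ln x / ln 2.

(* The value of the integrand at theta = 0 is irrelevant (a null set). *)
Definition sep_MPSK (R : realType) (M : nat) (x : R) : R :=
  let rho := log2 M%:R * sin (pi / M%:R) ^+ 2 in
  pi^-1 * \int[lebesgue_measure]_(theta in `[0, (M%:R - 1) / M%:R * pi]%classic)
            expR (- (rho * x / sin theta ^+ 2)).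

Definition bep_DQPSK (R : realType) (x : R) : R :=
  let a := Num.sqrt (2 * (1 - Num.sqrt (1 / 2))) in
  let b := Num.sqrt (2 * (1 + Num.sqrt (1 / 2))) in
  marcumQ1 (a * Num.sqrt x) (b * Num.sqrt x)
  - 2^-1 * besselI0 (Num.sqrt 2 * x) * expR (- (2 * x)).

Definition avg_error_prob (R : realType) (kappa mu m : R) (H : R -> R)
    (gbar : R) : R :=
  \int[lebesgue_measure]_(x in `]0, +oo[%classic)
    (kms_density kappa mu m gbar x * H x).

Definition has_diversity_order (R : realType) (Pe : R -> R) (d : R) : Prop :=
  - (ln (Pe gbar) / ln gbar) @[gbar --> +oo%R] --> d.

(* Main.v *)
Require Import Defs.
From HB Require Import structures.
From mathcomp Require Import all_boot all_order all_algebra.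
From mathcomp Require Import all_classical all_reals all_analysis.
From mathcomp Require Import measurable_realfun ring lra.
Set Implicit Arguments.
Unset Strict Implicit.
Unset Printing Implicit Defensive.
Import Order.TTheory GRing.Theory Num.Theory.
Import numFieldNormedType.Exports.
Local Open Scope classical_set_scope.
Local Open Scope ring_scope.

(* The density is gbar^(-mu) times a function of x that is squeezed, for large
   gbar, between constant multiples of x^(mu-1) e^(-nu1 x) and x^(mu-1) e^(c x)
   with c as small as we like: indeed 1 <= 1F1(m; mu; z) <= e^((1 + m/mu) z) for
   z >= 0, while nu and omega tend to 0 as gbar grows.  Hence as soon as
   h e^(-d x) <= H x <= k e^(-c x) with h, c > 0, the average error probability
   lies between two positive constant multiples of gbar^(-mu).

   Such bounds on H are immediate for M-PSK.  For DQPSK, monotonicity of I_0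
   gives Q_1(a, b) >= I_0(a b) e^(-(a^2 + b^2)/2), so that H_2 >= e^(-2x)/2, and
   I_0(z) <= e^z gives Q_1(a, b) <= b/(b - a) e^(-(b - a)^2/2).

   The integral of a nonnegative function is a supremum over the simple functions
   below it, hence monotone without any measurability assumption; this spares
   the measurability of H and of 1F1. *)

(** * Monotonicity of integrals of nonnegative functions *)

Lemma ge0_integral_le_subset d (T : measurableType d) (R : realType)
    (nu : {measure set T -> \bar R}) (A B : set T) (f g : T -> \bar R) :
  A `<=` B -> (forall x, B x -> 0 <= g x)%E ->
  (forall x, A x -> 0 <= f x <= g x)%E ->
  (\int[nu]_(x in A) f x <= \int[nu]_(x in B) g x)%E.
Proof.
move=> AB g0 fg; rewrite !ge0_integralE//; last by move=> x /fg /andP[].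
apply: le_ereal_sup => _ [h /= hf <-]; exists h => //= x.
apply: (le_trans (hf x)); rewrite /patch.
case: ifPn => [|_]; first rewrite inE => Ax.
  by rewrite mem_set; [case/andP: (fg x Ax)|exact: AB].
by case: ifPn => // /[1!inE] /g0.
Qed.

(** [Rintegral] reads an infinite integral as [0], so monotonicity needs the larger integral to be
    finite; the smaller one is then finite too. *)
Lemma Rintegral_le_subset d (T : measurableType d) (R : realType)
    (nu : {measure set T -> \bar R}) (A B : set T) (f g : T -> R) :
  A `<=` B -> (forall x, B x -> 0 <= g x) ->
  (forall x, A x -> 0 <= f x <= g x) ->
  (\int[nu]_(x in B) (g x)%:E < +oo)%E ->
  \int[nu]_(x in A) f x <= \int[nu]_(x in B) g x.
Proof.
move=> AB g0 fg goo.
have f0 : (0 <= \int[nu]_(x in A) (f x)%:E)%E.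
  by apply: integral_ge0 => x /fg /andP[]; rewrite lee_fin.
have le_fg : (\int[nu]_(x in A) (f x)%:E <= \int[nu]_(x in B) (g x)%:E)%E.
  exact: ge0_integral_le_subset.
by rewrite fine_le// ge0_fin_numE// ?(le_trans f0)// (le_lt_trans le_fg).
Qed.

(** * Gaussian tails and Gamma-type integrals *)

(** The linear factor makes the integrand an exact derivative. Both bounds on the Marcum function
    reduce to this integral, the lower one with [a = 0]. *)
Lemma integral_lin_gauss_tail (R : realType) (k a b : R) : 0 <= k -> a <= b ->
  (\int[lebesgue_measure]_(t in `[b, +oo[)
     (k * ((t - a) * expR (- ((t - a) ^+ 2 / 2))))%:E =
   (k * expR (- ((b - a) ^+ 2 / 2)))%:E)%E.
Proof.
move=> k0 ab.
pose F (t : R) : R := - (k * expR (- ((t - a) ^+ 2 / 2))).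
have dF (t : R) : is_derive t 1 F (k * ((t - a) * expR (- ((t - a) ^+ 2 / 2)))).
  by apply: is_derive_eq; rewrite /GRing.scale /=; field.
rewrite (@ge0_continuous_FTC2y _ _ F _ 0).
- by rewrite -EFinB /F sub0r opprK.
- by move=> t bt; rewrite mulr_ge0// mulr_ge0 ?expR_ge0// subr_ge0 (le_trans ab).
- apply: derivable_within_continuous => t _.
  by apply: ex_derive.
- suff : F x @[x --> +oo] --> - (k * 0) by rewrite mulr0 oppr0.
  apply: cvgN; apply: cvgMr.
  apply: (@cvg_comp _ _ _ (fun t => (t - a) ^+ 2 / 2) (fun t => expR (- t)) _ (pinfty_nbhs R)).
    apply/cvgryPge => A; near=> t.
    (* This suffices because [(|A| + 1) ^ 2 / 2 >= |A| >= A]. *)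
    have : `|A| + 1 <= t - a by rewrite lerBrDr; near: t; apply: nbhs_pinfty_ge; exact: num_real.
    move: (ler_norm A) (normr_ge0 A); nra.
  exact: cvgr_expR.
- by move=> t _; apply: ex_derive.
- apply: cvg_at_right_filter; apply: differentiable_continuous.
  by apply/derivable1_diffP; exact: ex_derive.
- by move=> t _; rewrite derive1E; exact: derive_val.
Unshelve. all: by end_near. Qed.

(* The dominating function is, up to a constant, the derivative of
   [(x / (1 + x)) `^ p], which is bounded and behaves like [x `^ p] at 0. *)
Lemma gamma_integrand_dominated (R : realType) (p c : R) : 0 < c ->
  exists k : R, 0 <= k /\ forall x : R, 0 < x ->
    x `^ (p - 1) * expR (- (c * x)) <=
    k * ((x / (1 + x)) `^ (p - 1) / (1 + x) ^+ 2).
Proof.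
(* [q] is positive and at least [p + 1]. The constant below comes from [ln y <= y] at
   [y = c / q * (1 + x)], multiplied by [q]. *)
move=> c0; pose q := `|p + 1| + 1; have q0 : 0 < q by rewrite ltr_wpDl.
exists (expR (c - q * ln (c / q))); split; first exact: expR_ge0.
move=> x x0; have x1 : 0 < 1 + x by rewrite addr_gt0.
have xV : 0 <= (1 + x)^-1 by rewrite invr_ge0 ltW.
have x0' := ltW x0.
rewrite powRM// -mulrA [leRHS]mulrCA ler_wpM2l ?powR_ge0//.
have -> : (1 + x)^-1 `^ (p - 1) / (1 + x) ^+ 2 = expR (- ((p + 1) * ln (1 + x))).
  rewrite -powR_inv1 ?ltW// -powRrM -powR_mulrn ?ltW// -powRN -powRD; last first.
    by rewrite (gt_eqF x1) implybT.
  by rewrite /powR gt_eqF//; congr expR; ring.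
rewrite -expRD ler_expR.
have L0 : 0 <= ln (1 + x) by rewrite ln_ge0// lerDl.
have Lq : ln (c / q) + ln (1 + x) <= c / q * (1 + x).
  by rewrite -lnM ?posrE ?divr_gt0// ltW// ln_sublinear// mulr_gt0 ?divr_gt0.
have pq : (p + 1) * ln (1 + x) <= q * ln (1 + x).
  by rewrite ler_wpM2r// ler_wpDr// ler_norm.
have := ler_wpM2l (ltW q0) Lq.
rewrite mulrA mulrCA divff ?gt_eqF// mulr1; lra.
Qed.

Lemma is_derive_powR_ratio (R : realType) (p x : R) : 0 < x ->
  is_derive x 1 (fun y : R => (y / (1 + y)) `^ p)
    (p * ((x / (1 + x)) `^ (p - 1) / (1 + x) ^+ 2)).
Proof.
move=> x0; have x1 : 0 < 1 + x by rewrite addr_gt0.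
have dq : is_derive x 1 (fun y : R => y / (1 + y)) ((1 + x) ^- 2).
  have nz : 1 + x != 0 by rewrite gt_eqF.
  by apply: is_derive_eq; rewrite /GRing.scale /=; field.
have dp := is_derive1_powR p (divr_gt0 x0 x1).
have dc := @is_derive1_comp _ (fun y : R => y `^ p)
  (fun y : R => y / (1 + y)) x _ _ dp dq.
by apply: is_derive_eq dc _; rewrite mulrA.
Qed.

Lemma cvg_powR_ratio (R : realType) (p : R) :
  (x / (1 + x)) `^ p @[x --> +oo] --> (1 : R).
Proof.
have cV : (1 + x)^-1 @[x --> +oo] --> (0 : R).
  apply/gtr0_cvgV0.
    near=> x; rewrite addr_gt0//; near: x; apply: nbhs_pinfty_gt; exact: num_real.
  apply/cvgryPge => A; near=> x; rewrite -lerBlDl.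
  near: x; apply: nbhs_pinfty_ge; exact: num_real.
have cq : x / (1 + x) @[x --> +oo] --> (1 : R).
  have : 1 - (1 + x)^-1 @[x --> +oo] --> (1 - 0 : R).
    by apply: cvgB => //; exact: cvg_cst.
  rewrite subr0; apply: cvg_trans; apply: near_eq_cvg; near=> x.
  have x0 : 0 < x by near: x; apply: nbhs_pinfty_gt; exact: num_real.
  have nz : 1 + x != 0 by rewrite gt_eqF// addr_gt0.
  by field.
have cp : {for 1, continuous (fun y : R => y `^ p)}.
  apply: differentiable_continuous; apply/derivable1_diffP.
  by have ? := is_derive1_powR p (@ltr01 R); exact: ex_derive.
by have := cvg_comp _ _ cq cp; rewrite powR1.
Unshelve. all: by end_near. Qed.

(** The antiderivative [F] is nonnegative at [a] and tends to [1] at infinity. The bound does not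
    depend on [a], which lets [a] tend to [0] even when the integrand blows up there. *)
Lemma integral_gamma_dominating_le1 (R : realType) (p a : R) : 0 < p -> 0 < a ->
  (\int[lebesgue_measure]_(x in `[a, +oo[)
     (p * ((x / (1 + x)) `^ (p - 1) / (1 + x) ^+ 2))%:E <= 1)%E.
Proof.
move=> p0 a0; pose F (x : R) := (x / (1 + x)) `^ p.
have gta x : a < x -> 0 < x by exact: lt_trans.
rewrite (@ge0_continuous_FTC2y _ _ F _ 1).
- by rewrite -EFinB lee_fin gerBl powR_ge0.
- by move=> x ax; rewrite mulr_ge0 ?(ltW p0)// divr_ge0 ?powR_ge0 ?sqr_ge0.
- apply: derivable_within_continuous => x; rewrite in_itv/= andbT => ax.
  have x0 : 0 < x by exact: lt_le_trans ax.
  have nz : (1 + x) ^+ 2 != 0 by rewrite expf_neq0// gt_eqF// addr_gt0.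
  by have ? := is_derive_powR_ratio (p - 1) x0; apply: ex_derive.
- exact: cvg_powR_ratio.
- by move=> x /gta /is_derive_powR_ratio -/(_ p) ?; apply: ex_derive.
- apply: cvg_at_right_filter; apply: differentiable_continuous.
  by apply/derivable1_diffP; have ? := is_derive_powR_ratio p a0; exact: ex_derive.
- move=> x; rewrite in_itv/= andbT derive1E => /gta /is_derive_powR_ratio -/(_ p) ?.
  exact: derive_val.
Qed.

Lemma bigcup_itv_invn_pinfty (R : realType) :
  \bigcup_n `[n.+1%:R^-1, +oo[%classic = `]0, +oo[%classic :> set R.
Proof.
apply/seteqP; split => [x [n _ /=]|x /=]; rewrite !in_itv/= !andbT => xn.
  by apply: lt_le_trans xn; rewrite invr_gt0 ltr0n.
exists (Num.truncn x^-1) => //=; rewrite in_itv/= andbT.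
by rewrite invf_ple ?posrE ?ltr0n// ltW// truncnS_gt.
Qed.

Lemma measurable_gamma_integrand (R : realType) (p c : R) (D : set R) :
  measurable_fun D (fun x : R => x `^ (p - 1) * expR (- (c * x))).
Proof.
apply: measurable_funTS; apply: measurable_funM; first exact: measurable_powR.
by apply: measurableT_comp => //; apply: measurableT_comp => //; exact: measurable_funM.
Qed.

(** The domination bounds the integrals over [[1 / (n + 1), +oo[] uniformly in [n]; monotone
    convergence carries the bound over to []0, +oo[]. *)
Lemma gamma_integral_fin (R : realType) (p c : R) : 0 < p -> 0 < c ->
  (\int[lebesgue_measure]_(x in `]0%R, +oo[) (x `^ (p - 1) * expR (- (c * x)))%:E < +oo)%E.
Proof.
move=> p0 c0; have [k [k0 dom]] := gamma_integrand_dominated p c0.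
have g0 x : 0 <= x `^ (p - 1) * expR (- (c * x)) by rewrite mulr_ge0 ?powR_ge0 ?expR_ge0.
have bnd n : (\int[lebesgue_measure]_(x in `[(n.+1%:R^-1)%R, +oo[)
    (x `^ (p - 1) * expR (- (c * x)))%:E <= (k / p)%:E)%E.
  have n0 : 0 < n.+1%:R^-1 :> R by rewrite invr_gt0 ltr0n.
  pose h (x : R) := p * ((x / (1 + x)) `^ (p - 1) / (1 + x) ^+ 2).
  have kp0 : 0 <= k / p by rewrite divr_ge0// ltW.
  have h0 x : 0 <= h x by rewrite mulr_ge0 ?(ltW p0)// divr_ge0 ?powR_ge0 ?sqr_ge0.
  apply: (@le_trans _ _ (\int[lebesgue_measure]_(x in `[(n.+1%:R^-1)%R, +oo[)
    ((k / p)%:E * (h x)%:E)%E)%E).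
    apply: ge0_integral_le_subset => //= x; first by move=> _; rewrite mule_ge0 ?lee_fin.
    rewrite in_itv/= andbT -EFinM !lee_fin g0 => nx /=.
    have -> : k / p * h x = k * ((x / (1 + x)) `^ (p - 1) / (1 + x) ^+ 2).
      by rewrite /h mulrA divfK// gt_eqF.
    by apply: dom; exact: lt_le_trans nx.
  rewrite ge0_integralZl_EFin//; last 2 first.
  - by move=> x _; rewrite lee_fin.
  - apply/measurable_EFinP; apply: subspace_continuous_measurable_fun => //.
    apply: derivable_within_continuous => x; rewrite in_itv/= andbT => nx.
    have x0 : 0 < x by exact: lt_le_trans nx.
    have nz : (1 + x) ^+ 2 != 0 by rewrite expf_neq0// gt_eqF// addr_gt0.
    by have ? := is_derive_powR_ratio (p - 1) x0; apply: ex_derive.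
  rewrite -[leRHS]mule1 lee_wpmul2l ?lee_fin//.
  exact: integral_gamma_dominating_le1.
rewrite -bigcup_itv_invn_pinfty.
suff : (\int[lebesgue_measure]_(x in \bigcup_n `[(n.+1%:R^-1)%R, +oo[%classic)
    (x `^ (p - 1) * expR (- (c * x)))%:E <= (k / p)%:E)%E.
  by move=> /le_lt_trans; apply; rewrite ltry.
have cv := @ge0_nondecreasing_set_cvg_integral _ (measurableTypeR R) R
  (fun n => `[(n.+1%:R^-1 : R), +oo[%classic) (fun x => (x `^ (p - 1) * expR (- (c * x)))%:E)
  lebesgue_measure.
apply: (cvge_to_le (cv _ _ _ _)) => //.
- apply/nondecreasing_seqP => n; apply/subsetPset => x /=.
  rewrite !in_itv/= !andbT; apply: le_trans.
  by rewrite lef_pV2 ?posrE ?ltr0n// ler_nat.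
- by move=> n; apply/measurable_EFinP; exact: measurable_gamma_integrand.
- by move=> n x _; rewrite lee_fin.
- exact: nearW.
Qed.

(** On [[1, 2]] one has [|ln x| <= ln 2], so there the integrand is at least the positive constant
    [k], and the interval has length [1]. *)
Lemma gamma_integral_gt0 (R : realType) (p c : R) : 0 < p -> 0 < c ->
  0 < \int[lebesgue_measure]_(x in `]0, +oo[) (x `^ (p - 1) * expR (- (c * x))).
Proof.
move=> p0 c0; pose k := expR (- (`|p - 1| * ln 2)) * expR (- (c * 2)).
have k0 : 0 < k by rewrite mulr_gt0 ?expR_gt0.
have kE : \int[lebesgue_measure]_(x in `[1, 2]) k = k.
  rewrite Rintegral_cst//= lebesgue_measure_itv/= lte_fin ltr1n/=.
  by ring.
rewrite -kE in k0; apply: (lt_le_trans k0).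
apply: Rintegral_le_subset.
- by move=> x /=; rewrite !in_itv/= andbT => /andP[/(lt_le_trans _)->].
- by move=> x _; rewrite mulr_ge0 ?powR_ge0 ?expR_ge0.
- move=> x /=; rewrite in_itv/= => /andP[x1 x2].
  rewrite mulr_ge0 ?expR_ge0//= ler_pM ?expR_ge0//; last first.
    by rewrite ler_expR lerN2 ler_wpM2l// ltW.
  have x0 : 0 < x by rewrite (lt_le_trans _ x1).
  rewrite /powR gt_eqF// ler_expR lerNl (le_trans (ler_norm _))// normrN normrM.
  rewrite ler_wpM2l// ger0_norm ?ln_ge0// ler_ln ?posrE//.
- exact: gamma_integral_fin.
Qed.

(** * Series bounds for [hyp1F1] and [besselI0] *)

Lemma bounded_nneg_series (R : realType) (u : R^nat) (b : R) :
  (forall n, 0 <= u n) -> (forall n, series u n <= b) ->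
  [/\ cvgn (series u), forall n, series u n <= limn (series u) &
      limn (series u) <= b].
Proof.
move=> u0 ub; have nd : nondecreasing_seq (series u) by exact: nondecreasing_series.
have cu : cvgn (series u).
  by apply: nondecreasing_is_cvgn => //; exists b => _ [n _ <-].
split => //; first exact: nondecreasing_cvgn_le.
by apply: limr_le => //; exact: nearW.
Qed.

Lemma series_exp_coeff_le_expR (R : realType) (x : R) n : 0 <= x ->
  series (exp_coeff x) n <= expR x.
Proof.
move=> x0; apply: nondecreasing_cvgn_le; last exact: is_cvg_series_exp_coeff.
by apply: nondecreasing_series => k _; by rewrite exp_coeff_ge0.
Qed.

Lemma rising_gt0 (R : realType) (a : R) n : 0 < a -> 0 < rising a n.
Proof. by move=> a0; apply: prodr_gt0 => i _; rewrite ltr_wpDr. Qed.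

(** The bound holds factor by factor: [(1 + a / b) * (b + i) = a + b + i + a / b * i >= a + i]. *)
Lemma rising_ratio_le (R : realType) (a b : R) n : 0 < a -> 0 < b ->
  rising a n / rising b n <= (1 + a / b) ^+ n.
Proof.
move=> a0 b0; rewrite /rising -prodf_div -[n in leRHS]card_ord -prodr_const.
apply: ler_prod => i _; have i0 : 0 <= i%:R :> R by [].
have bi : 0 < b + i%:R by rewrite ltr_wpDr.
rewrite divr_ge0 ?(ltW bi) ?addr_ge0 ?(ltW a0)//= ler_pdivrMr// mulrDl mul1r mulrDr divfK ?gt_eqF//.
have : 0 <= a / b * i%:R by rewrite mulr_ge0// divr_ge0// ltW.
lra.
Qed.

(** The lower bound is the term of index [0]; the upper one compares the series termwise with the
    exponential series at [(1 + a / b) * z]. *)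
Lemma hyp1F1_bounds (R : realType) (a b z : R) : 0 < a -> 0 < b -> 0 <= z ->
  1 <= hyp1F1 a b z <= expR ((1 + a / b) * z).
Proof.
move=> a0 b0 z0; set A := 1 + a / b; rewrite /hyp1F1.
have A0 : 0 <= A by rewrite addr_ge0// divr_ge0// ltW.
set u := (fun n : nat => _).
have rr0 n : 0 <= rising a n / rising b n by rewrite divr_ge0// ltW// rising_gt0.
have u0 n : 0 <= u n by rewrite mulr_ge0// divr_ge0// exprn_ge0.
have ub n : series u n <= expR (A * z).
  apply: le_trans (series_exp_coeff_le_expR n (mulr_ge0 A0 z0)).
  apply: ler_sum => k _; rewrite /u /exp_coeff /= exprMn -[leRHS]mulrA.
  by rewrite ler_wpM2r ?divr_ge0 ?exprn_ge0 ?rising_ratio_le.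
have [_ u_le lim_le] := bounded_nneg_series u0 ub; rewrite lim_le andbT.
apply: le_trans (u_le 1%N).
by rewrite seriesEord/= big_ord1 /u /rising !big_ord0 fact0 expr0 !divr1 mulr1.
Qed.

(** The terms are the squares of the exponential coefficients at [x / 2], and a sum of squares of
    nonnegative numbers is at most the square of their sum, here at most [expR (x / 2) ^ 2]. *)
Lemma besselI0_series (R : realType) (x : R) : 0 <= x ->
  let u (n : nat) : R := (x / 2) ^+ (2 * n) / n`!%:R ^+ 2 in
  [/\ cvgn (series u), forall n, series u n <= limn (series u) &
      limn (series u) <= expR x].
Proof.
move=> x0 u; have w0 : 0 <= x / 2 by rewrite divr_ge0.
have uE n : u n = exp_coeff (x / 2) n * exp_coeff (x / 2) n.
  by rewrite /u /exp_coeff /= [RHS]mulrACA -invfM -!expr2 -exprM mulnC.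
apply: bounded_nneg_series => n; first by rewrite uE mulr_ge0// exp_coeff_ge0.
apply: (@le_trans _ _ (\sum_(0 <= k < n) expR (x / 2) * exp_coeff (x / 2) k)).
  apply: ler_sum => k _; rewrite uE ler_wpM2r ?exp_coeff_ge0//.
  (* The coefficient of index [k] is the last summand of the partial sum with [k.+1] terms. *)
  apply: le_trans (series_exp_coeff_le_expR k.+1 w0).
  rewrite seriesEnat/= big_nat_recr//= lerDr.
  by apply: sumr_ge0 => j _; by rewrite exp_coeff_ge0.
rewrite -mulr_sumr {3}(splitr x) expRD ler_wpM2l ?expR_ge0//.
exact: series_exp_coeff_le_expR.
Qed.

Lemma besselI0_le_expR (R : realType) (x : R) : 0 <= x -> besselI0 x <= expR x.
Proof. by move=> /besselI0_series[]. Qed.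

Lemma besselI0_ge1 (R : realType) (x : R) : 0 <= x -> 1 <= besselI0 x.
Proof.
move=> /besselI0_series[_ /(_ 1%N) + _]; apply: le_trans.
by rewrite seriesEord/= big_ord1 muln0 expr0 fact0 expr1n divr1.
Qed.

Lemma besselI0_homo (R : realType) (x y : R) : 0 <= x -> x <= y ->
  besselI0 x <= besselI0 y.
Proof.
move=> x0 xy; have [cx _ _] := besselI0_series x0.
have [cy _ _] := besselI0_series (le_trans x0 xy).
apply: lim_series_le => // n.
rewrite ler_wpM2r ?invr_ge0 ?exprn_ge0// lerXn2r ?nnegrE ?divr_ge0//.
  exact: le_trans xy.
by rewrite ler_wpM2r.
Qed.

(** * Two-sided bounds for the Marcum function *)

(* [I_0 z <= e^z] completes the square in the exponent, and [a < b <= t] gives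
   [t <= b / (b - a) * (t - a)], which makes the bound exactly integrable. *)
Lemma marcumQ1_integrand_le (R : realType) (a b t : R) : 0 <= a -> a < b -> b <= t ->
  0 <= t * expR (- ((t ^+ 2 + a ^+ 2) / 2)) * besselI0 (a * t) <=
  b / (b - a) * ((t - a) * expR (- ((t - a) ^+ 2 / 2))).
Proof.
move=> a0 ab bt; have t0 : 0 <= t by lra.
have I0 : 0 <= besselI0 (a * t).
  by rewrite (le_trans _ (besselI0_ge1 _)) ?mulr_ge0.
rewrite mulr_ge0 ?mulr_ge0 ?expR_ge0//=.
apply: (@le_trans _ _ (t * expR (- ((t - a) ^+ 2 / 2)))).
  rewrite -mulrA ler_wpM2l//.
  have -> : - ((t - a) ^+ 2 / 2) = - ((t ^+ 2 + a ^+ 2) / 2) + a * t by field.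
  by rewrite expRD ler_wpM2l ?expR_ge0// besselI0_le_expR// mulr_ge0.
rewrite mulrA ler_wpM2r ?expR_ge0//.
rewrite mulrAC ler_pdivlMr ?subr_gt0//; nra.
Qed.

Lemma marcumQ1_integral_fin (R : realType) (a b : R) : 0 <= a -> a < b ->
  (\int[lebesgue_measure]_(t in `[b, +oo[)
    (t * expR (- ((t ^+ 2 + a ^+ 2) / 2)) * besselI0 (a * t))%:E < +oo)%E.
Proof.
move=> a0 ab; apply: le_lt_trans (ltry (b / (b - a) * expR (- ((b - a) ^+ 2 / 2)))).
have k0 : 0 <= b / (b - a) by rewrite divr_ge0//; lra.
rewrite -(integral_lin_gauss_tail k0 (ltW ab)).
apply: ge0_integral_le_subset => // t /=; rewrite in_itv/= andbT => bt.
  by rewrite lee_fin mulr_ge0// mulr_ge0 ?expR_ge0//; lra.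
by rewrite !lee_fin marcumQ1_integrand_le.
Qed.

Lemma marcumQ1_le (R : realType) (a b : R) : 0 <= a -> a < b ->
  marcumQ1 a b <= b / (b - a) * expR (- ((b - a) ^+ 2 / 2)).
Proof.
move=> a0 ab; have k0 : 0 <= b / (b - a) by rewrite divr_ge0//; lra.
have tail := integral_lin_gauss_tail k0 (ltW ab).
(* Reading the bound as a [fine] value lets [tail] turn it back into an integral, so that integrands
   can be compared. *)
rewrite -[leRHS]/(fine _%:E) -tail; apply: Rintegral_le_subset => //.
- move=> t /=; rewrite in_itv/= andbT => bt.
  by rewrite mulr_ge0// mulr_ge0 ?expR_ge0//; lra.
- by move=> t /=; rewrite in_itv/= andbT => bt; rewrite marcumQ1_integrand_le.
- by rewrite tail ltry.
Qed.

(* [I_0] is nondecreasing, hence [I_0 (a * t)] is at least [I_0 (a * b)] on the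
   range of integration; what remains is a Gaussian tail. *)
Lemma marcumQ1_ge (R : realType) (a b : R) : 0 <= a -> a < b ->
  besselI0 (a * b) * expR (- ((a ^+ 2 + b ^+ 2) / 2)) <= marcumQ1 a b.
Proof.
move=> a0 ab; have b0 : 0 <= b by lra.
(* [k] collects the factors constant in [t]; the tail that remains is centred at [0], whence [b - 0]
   below. *)
pose k := besselI0 (a * b) * expR (- (a ^+ 2 / 2)).
have I0 : 0 <= besselI0 (a * b) by rewrite (le_trans _ (besselI0_ge1 _)) ?mulr_ge0.
have k0 : 0 <= k by rewrite mulr_ge0 ?expR_ge0.
have -> : besselI0 (a * b) * expR (- ((a ^+ 2 + b ^+ 2) / 2)) =
    k * expR (- ((b - 0) ^+ 2 / 2)).
  by rewrite -mulrA -expRD; congr (_ * expR _); field.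
rewrite -[leLHS]/(fine _%:E) -(integral_lin_gauss_tail k0 b0).
apply: Rintegral_le_subset => //; last exact: marcumQ1_integral_fin.
  move=> t /=; rewrite in_itv/= andbT => bt.
  by have /andP[] := marcumQ1_integrand_le a0 ab bt.
move=> t /=; rewrite in_itv/= andbT subr0 => bt; have t0 : 0 <= t by lra.
rewrite mulr_ge0 ?mulr_ge0 ?expR_ge0//=.
have -> : k * (t * expR (- (t ^+ 2 / 2))) =
    t * expR (- ((t ^+ 2 + a ^+ 2) / 2)) * besselI0 (a * b).
  have -> : - ((t ^+ 2 + a ^+ 2) / 2) = - (a ^+ 2 / 2) + - (t ^+ 2 / 2) by field.
  by rewrite expRD /k; ring.
rewrite ler_wpM2l ?mulr_ge0 ?expR_ge0//.
by apply: besselI0_homo; [exact: mulr_ge0|rewrite ler_wpM2l].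
Qed.

(** * From exponential bounds on the conditional error probability to the diversity order *)

(** After taking logarithms, the quotient lies between [l - ln c2 / ln g] and [l - ln c1 / ln g],
    which both tend to [l]. *)
Lemma has_diversity_order_powR_bounds (R : realType) (P : R -> R) (l c1 c2 : R) :
  0 < c1 ->
  (\forall g \near +oo, c1 / g `^ l <= P g <= c2 / g `^ l) ->
  has_diversity_order P l.
Proof.
move=> c1_gt0 bnd.
have lnV : (ln g)^-1 @[g --> +oo] --> (0 : R).
  apply/gtr0_cvgV0.
    by near=> g; apply: ln_gt0; near: g; apply: nbhs_pinfty_gt; exact: num_real.
  apply/cvgryPge => A; near=> g.
  have gA : expR A <= g by near: g; apply: nbhs_pinfty_ge; exact: num_real.
  by rewrite -(expRK A) ler_ln ?posrE ?expR_gt0// (lt_le_trans (expR_gt0 A)).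
have lim c : l - ln c * (ln g)^-1 @[g --> +oo] --> l.
  rewrite -[X in _ --> X]subr0 -[X in _ - X](mulr0 (ln c)).
  by apply: cvgB; [exact: cvg_cst|exact: cvgMr].
apply: (squeeze_cvgr _ (lim c2) (lim c1)); near=> g.
have g1 : 1 < g by near: g; apply: nbhs_pinfty_gt; exact: num_real.
have g0 : 0 < g by exact: lt_trans g1.
have /andP[lo up] : c1 / g `^ l <= P g <= c2 / g `^ l by near: g.
have lg : 0 < ln g := ln_gt0 g1.
have pg : 0 < g `^ l by exact: powR_gt0.
have P0 : 0 < P g by rewrite (lt_le_trans _ lo)// divr_gt0.
(* Positivity of [c2] follows from [0 < P g <= c2 / g ^ l]. *)
have c2_gt0 : 0 < c2.
  by have := lt_le_trans P0 up; rewrite pmulr_lgt0// invr_gt0.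
move: lo up; rewrite -ler_ln ?posrE ?divr_gt0// -[in X in _ -> X -> _]ler_ln ?posrE ?divr_gt0//.
rewrite !ln_div ?posrE// ln_powR => lo up.
rewrite -!mulNr; apply/andP; split.
  rewrite ler_pdivlMr// mulrDl divfK ?gt_eqF//; lra.
rewrite ler_pdivrMr// mulrDl divfK ?gt_eqF//; lra.
Unshelve. all: by end_near. Qed.

Lemma Gamma_gt0 (R : realType) (s : R) : 0 < s -> 0 < Gamma s.
Proof.
move=> s0; have := gamma_integral_gt0 s0 ltr01.
by rewrite /Gamma; under eq_Rintegral do rewrite mul1r.
Qed.

(** For [g >= 1] the exponential factor lies between [expR (- (nu1 * x))] and [1], while [hyp1F1]
    lies between [1] and [expR (om1 / g * x)]. The rate [c] is quantified after the constants so
    that it can be fixed according to the decay of the error probability. *)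
Lemma kms_density_bounds (R : realType) (kappa mu m : R) :
  0 < mu -> 0 < m -> 0 <= kappa ->
  exists C nu1 om1 : R, [/\ 0 < C, 0 < nu1 &
    forall g x c : R, 1 <= g -> 0 < x -> om1 <= c * g ->
      C / g `^ mu * (x `^ (mu - 1) * expR (- (nu1 * x)))
      <= kms_density kappa mu m g x <=
      C / g `^ mu * (x `^ (mu - 1) * expR (c * x))].
Proof.
move=> mu0 m0 kappa0.
have k1 : 0 < 1 + kappa by rewrite ltr_pwDl.
have [d d0 dE] : exists2 d, 0 < d & mu * kappa + m = d.
  by exists (mu * kappa + m) => //; rewrite ltr_wpDl// mulr_ge0// ltW.
have [lam lam0 lamE] : exists2 lam, 0 < lam &
    forall g, kms_lambda kappa mu m g = lam / g `^ mu.
  exists (mu `^ mu * m `^ m * (1 + kappa) `^ mu / d `^ m).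
    by rewrite divr_gt0 ?mulr_gt0 ?powR_gt0.
  by move=> g; rewrite /kms_lambda dE invfM mulrA mulrAC.
have [nu1 nu0 nuE] : exists2 nu1, 0 < nu1 &
    forall g, kms_nu kappa mu g = nu1 / g.
  by exists (mu * (1 + kappa)) => //; rewrite mulr_gt0.
have [om om0 omE] : exists2 om, 0 <= om &
    forall g, kms_omega kappa mu m g = om / g.
  exists (mu ^+ 2 * kappa * (1 + kappa) / d).
    by rewrite divr_ge0 ?(ltW d0)// mulr_ge0 ?(ltW k1)// mulr_ge0// sqr_ge0.
  by move=> g; rewrite /kms_omega dE invfM mulrA mulrAC.
have Gam0 := Gamma_gt0 mu0.
(* The third witness is [g] times the growth rate in the upper bound on [hyp1F1]. *)
exists (lam / Gamma mu), nu1, (om * (1 + m / mu)); split => //.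
  by rewrite divr_gt0.
move=> g x c g1 x0 omg; have g0 : 0 < g by exact: lt_le_trans g1.
have -> : kms_density kappa mu m g x = lam / Gamma mu / g `^ mu *
    (x `^ (mu - 1) * (expR (- (nu1 / g * x)) * hyp1F1 m mu (om / g * x))).
  rewrite /kms_density lamE omE nuE !mulrA; congr (_ * _ * _ * _).
  by rewrite mulrAC.
have C0 : 0 <= lam / Gamma mu / g `^ mu.
  by rewrite divr_ge0 ?powR_ge0// ltW// divr_gt0.
have z0 : 0 <= om / g * x by rewrite mulr_ge0 ?divr_ge0// ltW.
have /andP[F1 Fexp] := hyp1F1_bounds m0 mu0 z0.
have nug : nu1 / g <= nu1 by rewrite ler_pdivrMr// ler_peMr// ltW.
apply/andP; split; rewrite ler_wpM2l// ler_wpM2l ?powR_ge0//.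
  apply: (@le_trans _ _ (expR (- (nu1 / g * x)))).
    by rewrite ler_expR lerN2 ler_wpM2r// ltW.
  by rewrite ler_peMr// expR_ge0.
rewrite -[leRHS]mul1r ler_pM ?expR_ge0//; first exact: le_trans F1.
  by rewrite -expR0 ler_expR oppr_le0 mulr_ge0 ?divr_ge0// ltW.
apply: (le_trans Fexp); rewrite ler_expR mulrA ler_wpM2r ?(ltW x0)//.
by rewrite mulrA ler_pdivrMr// [leLHS]mulrC.
Qed.

(** Multiplying the bounds on the density and on [H] gives integrands whose dependence on [g] is
    only the factor [1 / g ^ mu]; their integrals [I] are finite and positive constants. *)
Lemma diversity_order_exp_bounds (R : realType) (kappa mu m : R) (H : R -> R)
    (h d k c : R) :
  0 < mu -> 0 < m -> 0 <= kappa -> 0 < h -> 0 <= d -> 0 < c ->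
  (forall x, 0 < x -> h * expR (- (d * x)) <= H x <= k * expR (- (c * x))) ->
  has_diversity_order (avg_error_prob kappa mu m H) mu.
Proof.
move=> mu0 m0 kappa0 h0 d0 c0 Hb.
have [C [nu1 [om1 [C0 nu0 fb]]]] := kms_density_bounds mu0 m0 kappa0.
pose I (s : R) := \int[lebesgue_measure]_(x in `]0, +oo[) (x `^ (mu - 1) * expR (- (s * x))).
have nud : 0 < nu1 + d by rewrite ltr_pwDl.
(* Half of the decay rate of [H] absorbs the growth allowed in the density bound for large [g]; the
   other half keeps the integral finite. *)
have c2 : 0 < c / 2 by rewrite divr_gt0.
have k0 : 0 <= k.
  have /andP[lo up] := Hb 1 ltr01.
  by rewrite -(pmulr_lge0 _ (expR_gt0 (- (c * 1)))) (le_trans _ (le_trans lo up))// mulr_ge0 ?expR_ge0// ltW.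
have scale (a s : R) : 0 <= a -> 0 < s ->
    (\int[lebesgue_measure]_(x in `]0%R, +oo[) (a * (x `^ (mu - 1) * expR (- (s * x))))%:E
      = (a * I s)%:E)%E.
  move=> a0 s0; under eq_integral do rewrite EFinM.
  rewrite ge0_integralZl_EFin//.
  - rewrite EFinM /I /Rintegral fineK// ge0_fin_numE; first exact: gamma_integral_fin.
    by apply: integral_ge0 => x _; rewrite lee_fin mulr_ge0 ?powR_ge0 ?expR_ge0.
  - by move=> x _; rewrite lee_fin mulr_ge0 ?powR_ge0 ?expR_ge0.
  - by apply/measurable_EFinP; exact: measurable_gamma_integrand.
apply: (@has_diversity_order_powR_bounds _ _ _ (C * h * I (nu1 + d)) (C * k * I (c / 2))).
  by rewrite !mulr_gt0// gamma_integral_gt0.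
near=> g.
have g1 : 1 <= g by near: g; apply: nbhs_pinfty_ge; exact: num_real.
have omg : om1 <= c / 2 * g.
  have gom : om1 / (c / 2) <= g by near: g; apply: nbhs_pinfty_ge; exact: num_real.
  by rewrite mulrC -ler_pdivrMr.
have gp : 0 < g `^ mu by rewrite powR_gt0// (lt_le_trans _ g1).
pose a := C / g `^ mu; have a0 : 0 <= a by rewrite divr_ge0// ltW.
have ah : 0 <= a * h by rewrite mulr_ge0// ltW.
have ak : 0 <= a * k by rewrite mulr_ge0.
have point x : 0 < x ->
    a * h * (x `^ (mu - 1) * expR (- ((nu1 + d) * x))) <=
    kms_density kappa mu m g x * H x <=
    a * k * (x `^ (mu - 1) * expR (- (c / 2 * x))).
  move=> x0; have /andP[Hlo Hup] := Hb x x0.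
  have /andP[flo fup] := fb _ _ _ g1 x0 omg.
  have lo0 : 0 <= h * expR (- (d * x)) by rewrite mulr_ge0 ?expR_ge0// ltW.
  have f0 : 0 <= a * (x `^ (mu - 1) * expR (- (nu1 * x))).
    by rewrite mulr_ge0// mulr_ge0 ?powR_ge0 ?expR_ge0.
  apply/andP; split.
    have -> : a * h * (x `^ (mu - 1) * expR (- ((nu1 + d) * x))) =
        a * (x `^ (mu - 1) * expR (- (nu1 * x))) * (h * expR (- (d * x))).
      by rewrite mulrDl opprD expRD; ring.
    by rewrite ler_pM.
  have -> : a * k * (x `^ (mu - 1) * expR (- (c / 2 * x))) =
      a * (x `^ (mu - 1) * expR (c / 2 * x)) * (k * expR (- (c * x))).
    have -> : - (c / 2 * x) = c / 2 * x + - (c * x) by field.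
    by rewrite expRD; ring.
  by apply: ler_pM => //; [exact: le_trans f0 flo|exact: le_trans lo0 Hlo].
have P0 x : 0 < x -> 0 <= kms_density kappa mu m g x * H x.
  move=> x0; have /andP[+ _] := point _ x0; apply: le_trans.
  by rewrite mulr_ge0// mulr_ge0 ?powR_ge0 ?expR_ge0.
(* Finiteness ensures that the average is the true integral and not the default value [0], as the
   lower bound requires. *)
have Pfin : (\int[lebesgue_measure]_(x in `]0%R, +oo[)
    (kms_density kappa mu m g x * H x)%:E < +oo)%E.
  apply: le_lt_trans (ltry (a * k * I (c / 2))); rewrite -scale//.
  apply: ge0_integral_le_subset => // x /=; rewrite in_itv/= andbT => x0.
    by rewrite lee_fin mulr_ge0// mulr_ge0 ?powR_ge0 ?expR_ge0.
  by rewrite !lee_fin P0//=; case/andP: (point _ x0).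
have -> : C * h * I (nu1 + d) / g `^ mu = a * h * I (nu1 + d) by rewrite /a; ring.
have -> : C * k * I (c / 2) / g `^ mu = a * k * I (c / 2) by rewrite /a; ring.
apply/andP; split.
  rewrite -[leLHS]/(fine (a * h * I (nu1 + d))%:E) -scale//; apply: Rintegral_le_subset => // x /=;
    rewrite in_itv/= andbT => x0; first exact: P0.
  apply/andP; split; last by case/andP: (point _ x0).
  by rewrite (mulr_ge0 ah)// mulr_ge0 ?powR_ge0 ?expR_ge0.
rewrite -[leRHS]/(fine (a * k * I (c / 2))%:E) -scale//; apply: Rintegral_le_subset => //.
- by move=> x _; rewrite mulr_ge0// mulr_ge0 ?powR_ge0 ?expR_ge0.
- by move=> x /=; rewrite in_itv/= andbT => x0; rewrite P0//=; case/andP: (point _ x0).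
- by rewrite scale// ltry.
Unshelve. all: by end_near. Qed.

(** * Exponential bounds for the two modulation schemes *)

(** Since [a * b = sqrt 2] and [a ^ 2 + b ^ 2 = 4], the lower bound on the Marcum function is
    exactly twice the subtracted Bessel term, so at least one copy of that term survives. For the
    upper bound the subtracted term is dropped. *)
Lemma bep_DQPSK_bounds (R : realType) : exists k c : R, 0 < c /\
  forall x : R, 0 < x ->
    2^-1 * expR (- (2 * x)) <= bep_DQPSK x <= k * expR (- (c * x)).
Proof.
set s := Num.sqrt (1 / 2 : R).
have s0 : 0 < s by rewrite sqrtr_gt0 divr_gt0.
have ss : s ^+ 2 = 1 / 2 by rewrite sqr_sqrtr// divr_ge0.
have s1 : s < 1 by nra.
set a := Num.sqrt (2 * (1 - s)); set b := Num.sqrt (2 * (1 + s)).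
have a2 : a ^+ 2 = 2 * (1 - s) by rewrite sqr_sqrtr//; lra.
have b2 : b ^+ 2 = 2 * (1 + s) by rewrite sqr_sqrtr//; lra.
have a0 : 0 <= a by exact: sqrtr_ge0.
have ab : a < b by rewrite ltr_sqrt; lra.
have abE : a * b = Num.sqrt 2.
  rewrite -sqrtrM; last by lra.
  congr Num.sqrt; have -> : 2 * (1 - s) * (2 * (1 + s)) = 4 * (1 - s ^+ 2) by ring.
  by rewrite ss; field.
exists (b / (b - a)), ((b - a) ^+ 2 / 2); split.
  by rewrite divr_gt0// exprn_gt0// subr_gt0.
move=> x x0; rewrite /bep_DQPSK -/s -/a -/b.
set q := Num.sqrt x.
have q0 : 0 < q by rewrite sqrtr_gt0.
have qq : q ^+ 2 = x by rewrite sqr_sqrtr// ltW.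
have aq0 : 0 <= a * q by rewrite mulr_ge0// ltW.
have abq : a * q < b * q by rewrite ltr_pM2r.
have lo := marcumQ1_ge aq0 abq; have up := marcumQ1_le aq0 abq.
have xs0 : 0 <= Num.sqrt 2 * x by rewrite mulr_ge0 ?sqrtr_ge0// ltW.
have I1 := besselI0_ge1 xs0.
have e0 := expR_ge0 (- (2 * x)).
have abx : a * q * (b * q) = Num.sqrt 2 * x by rewrite mulrACA abE -expr2 qq.
have e2 : (a * q) ^+ 2 + (b * q) ^+ 2 = 4 * x by rewrite !exprMn a2 b2 qq; ring.
rewrite abx e2 (_ : 4 * x / 2 = 2 * x) in lo; last by field.
(* The common factor [q = sqrt x] cancels in the prefactor and becomes [x] in the exponent. *)
have kE : b * q / (b * q - a * q) = b / (b - a).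
  by rewrite -mulrBl -mulf_div divff ?mulr1// gt_eqF.
have cE : (b * q - a * q) ^+ 2 / 2 = (b - a) ^+ 2 / 2 * x.
  by rewrite -mulrBl exprMn qq mulrAC.
rewrite kE cE in up.
have Ie : expR (- (2 * x)) <= besselI0 (Num.sqrt 2 * x) * expR (- (2 * x)).
  by rewrite ler_peMl.
rewrite -mulrA; apply/andP; split; lra.
Qed.

(** Above, [sin t ^ 2 <= 1] bounds the integrand by [expR (- (rho * x))] away from [t = 0], and the
    range is shorter than [pi]. Below, the integral is restricted to [[pi / 4, pi / 2]], which lies
    in the range because [M >= 2]. *)
Lemma sep_MPSK_bounds (R : realType) (M : nat) : (2 <= M)%N ->
  exists h d c : R, [/\ 0 < h, 0 <= d, 0 < c & forall x : R, 0 < x ->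
    h * expR (- (d * x)) <= sep_MPSK M x <= 1 * expR (- (c * x))].
Proof.
move=> M2; have M1 : 1 < M%:R :> R by rewrite ltr1n.
have M2R : 2 <= M%:R :> R by rewrite ler_nat.
have M0 : 0 < M%:R :> R by lra.
have pi0 : 0 < pi :> R := pi_gt0 R.
set rho := log2 M%:R * sin (pi / M%:R) ^+ 2 : R.
have rho0 : 0 < rho.
  rewrite mulr_gt0 ?divr_gt0 ?ln_gt0 ?ltr1n// exprn_gt0// sin_gt0_pi// divr_gt0//=.
  by rewrite ltr_pdivrMr// ltr_pMr.
set L := (M%:R - 1) / M%:R * pi : R.
have Lpi : L < pi by rewrite /L gtr_pMl// ltr_pdivrMr// mul1r; lra.
have L2 : pi / 2 <= L.
  by rewrite /L mulrC ler_wpM2r ?(ltW pi0)// ler_pdivlMr// mulrC; lra.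
set s := sin (pi / 4) : R.
have s0 : 0 < s by rewrite sin_gt0_pi//; lra.
have sinL t : 0 < t -> t <= L -> 0 < sin t.
  by move=> t0 tL; rewrite sin_gt0_pi// t0 (le_lt_trans tL).
(* [4^-1] is the length [pi / 4] of the restricted interval divided by [pi]; [s] is the least value
   of [sin] on it. *)
exists 4^-1, (rho / s ^+ 2), rho; split => //; first by rewrite divr_ge0 ?sqr_ge0// ltW.
move=> x x0; rewrite mul1r /sep_MPSK -/rho -/L.
have rx : 0 <= rho * x by rewrite mulr_ge0// ltW.
(* dominates the integrand also at [0], where it is [1] because [1 / 0 = 0] *)
pose g (t : R) : R := if t == 0 then 1 else expR (- (rho * x)).
have gE : (\int[lebesgue_measure]_(t in `[0%R, L]) (g t)%:E =
           (L * expR (- (rho * x)))%:E)%E.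
  have gcst : {in `]0, L]%classic, (fun=> (expR (- (rho * x)))%:E) =1 (fun t => (g t)%:E)}.
    move=> t; rewrite inE/= in_itv/= => /andP[t0 _].
    by rewrite /g gt_eqF.
  (* Removing the endpoint [0] leaves a constant integrand. *)
  rewrite -integral_itv_obnd_cbnd; last first.
    apply: eq_measurable_fun (measurable_cst (expR (- (rho * x)))%:E); exact: gcst.
  rewrite (eq_integral (cst (expR (- (rho * x)))%:E)); last first.
    by move=> t tI; rewrite -gcst.
  rewrite integral_cst//= lebesgue_measure_itv/= lte_fin.
  rewrite (lt_le_trans _ L2) ?divr_gt0//= -EFinD subr0 -EFinM.
  by rewrite mulrC.
have fg t : t \in `[0, L] ->
    0 <= expR (- (rho * x / sin t ^+ 2)) <= g t.
  rewrite in_itv/= => /andP[t0 tL]; rewrite expR_ge0/= /g; case: eqP => [_|/eqP tn0].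
    by rewrite -expR0 ler_expR oppr_le0 divr_ge0// sqr_ge0.
  have {tn0}t0 : 0 < t by rewrite lt_def tn0.
  by rewrite ler_expR lerN2 ler_peMr// invf_ge1 ?exprn_gt0 ?sinL.
have g0 t : 0 <= g t by rewrite /g; case: ifP => _; rewrite ?expR_ge0.
have up := @Rintegral_le_subset _ _ R lebesgue_measure `[0, L]%classic `[0, L]%classic _ g
  (@subset_refl _ _) (fun t _ => g0 t) fg.
have upfin : (\int[lebesgue_measure]_(t in `[0%R, L])
    (expR (- (rho * x / sin t ^+ 2)))%:E < +oo)%E.
  apply: le_lt_trans (ltry (L * expR (- (rho * x)))); rewrite -gE.
  by apply: ge0_integral_le_subset => // t /fg; rewrite !lee_fin.
apply/andP; split; last first.
  rewrite mulrC ler_pdivrMr//; apply: le_trans (up _) _; first by rewrite gE ltry.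
  by rewrite /Rintegral gE/= mulrC ler_wpM2l ?expR_ge0// ltW.
pose e := expR (- (rho / s ^+ 2 * x)).
have eE : \int[lebesgue_measure]_(t in `[(pi / 4 : R), pi / 2]) e = pi * (4^-1 * e).
  rewrite Rintegral_cst//= lebesgue_measure_itv/= lte_fin ifT ?EFinN/=; last by lra.
  by field.
rewrite -/e [leRHS]mulrC ler_pdivlMr// mulrC -eE.
apply: Rintegral_le_subset upfin.
- by move=> t /=; rewrite !in_itv/=; lra.
- by move=> t _; exact: expR_ge0.
move=> t /=; rewrite in_itv/= => /andP[t4 t2]; rewrite /e expR_ge0/=.
rewrite ler_expR lerN2 [leRHS]mulrAC ler_wpM2l//.
have sst : s <= sin t.
  rewrite /s; have := t4; rewrite le_eqVlt => /predU1P[->//|t4'].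
  by rewrite ltW// ltr_sin// in_itv/=; lra.
have st0 : 0 < sin t by exact: lt_le_trans sst.
by rewrite lef_pV2 ?posrE ?exprn_gt0// lerXn2r ?nnegrE ?(ltW s0) ?(ltW st0).
Qed.

Theorem mainTheorem4 (R : realType) (kappa mu m : R) (M : nat)
    (mu_gt0 : 0 < mu) (m_gt0 : 0 < m) (kappa_ge0 : 0 <= kappa)
    (M_ge2 : (2 <= M)%N) (M_pow2 : exists k : nat, M = (2 ^ k)%N) :
  has_diversity_order (avg_error_prob kappa mu m (@sep_MPSK R M)) mu /\
  has_diversity_order (avg_error_prob kappa mu m (@bep_DQPSK R)) mu.
Proof.
split.
  have [h [d [c [h0 d0 c0 Hb]]]] := sep_MPSK_bounds R M_ge2.
  exact: (diversity_order_exp_bounds mu_gt0 m_gt0 kappa_ge0 h0 d0 c0 Hb).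
have [k [c [c0 Hb]]] := bep_DQPSK_bounds R.
apply: (diversity_order_exp_bounds mu_gt0 m_gt0 kappa_ge0 _ _ c0 Hb) => //.
Qed.
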